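(* Let $p_1 < p_2 < p_3 < \cdots$ denote the odd primes in increasing order ($p_1 = 3$, $p_2 = 5$, $\ldots$). Assume that the following statement (C) holds. (C) For every integer $k \geq 1$ and every even integer $n \geq 6$ with $n > p_k$: if for all $1 \leq i \leq k$ the integer $n - p_i$ is not prime, then there is an integer $i$ with $1 \leq i \leq k$ for which $n - p_i$ has a prime factor $p$ such that $p \geq p_k$. Then for every even integer $n \geq 6$ there is a prime $p < n$ such that $n - p$ is prime.
   Context: The result is conditional: statement (C) is a conjecture, and the theorem asserts that (C) implies the stated conclusion (Goldbach's conjecture). ''Prime'' means a positive prime integer; in particular $1$ is not prime and has no prime factors. *)

(* Defs.v *)
From mathcomp Require Import all_boot.

Set Implicit Arguments.
Unset Strict Implicit.
Unset Printing Implicit Defensive.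

Lemma exists_prime_above (m : nat) : exists p, prime p && (m < p).
Proof. by have [p ltmp pr_p] := prime_above m; exists p; rewrite pr_p. Qed.

Definition next_prime (m : nat) : nat := ex_minn (exists_prime_above m).

(* 1-based: odd_prime 1 = 3, odd_prime 2 = 5, and so on; odd_prime 0 = 2 is
   only the starting point of the iteration and is not an odd prime. *)
Definition odd_prime (k : nat) : nat := iter k next_prime 2.

Lemma next_primeP (m : nat) :
  [/\ prime (next_prime m), m < next_prime m
    & forall q, prime q -> m < q -> next_prime m <= q].
Proof.
rewrite /next_prime; case: ex_minnP => p /andP[pr_p ltmp] minp.
by split=> // q pr_q ltmq; apply: minp; rewrite pr_q.
Qed.

Lemma odd_prime_ltS (k : nat) : odd_prime k < odd_prime k.+1.
Proof. by rewrite [odd_prime k.+1]iterS; case: (next_primeP (odd_prime k)). Qed.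

Lemma odd_primeP (q : nat) :
  prime q /\ odd q <-> exists2 k, 1 <= k & odd_prime k = q.
Proof.
split=> [[pr_q odd_q] | [[|k] // _ <-]]; last first.
  have [pr_p _ _] := next_primeP (odd_prime k).
  have lt2 : 2 < odd_prime k.+1.
    elim: k {pr_p} => [|k IHk]; first exact: (odd_prime_ltS 0).
    exact: ltn_trans IHk (odd_prime_ltS _).
  split; first by rewrite /odd_prime iterS.
  have pr : prime (odd_prime k.+1) by rewrite /odd_prime iterS.
  by case: (even_prime pr) => // p2; rewrite p2 in lt2.
have le_id k : k < odd_prime k.
  by elim: k => // k IHk; apply: leq_ltn_trans IHk (odd_prime_ltS k).
have lt2q : odd_prime 0 < q.
  by rewrite ltn_neqAle prime_gt1 // andbT; apply/eqP=> q2; rewrite -q2 in odd_q.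
have ex_k : exists k, q <= odd_prime k by exists q; apply: ltnW.
case: (ex_minnP ex_k) => -[|k] leqk mink; first by rewrite leqNgt lt2q in leqk.
exists k.+1 => //; apply/eqP; rewrite eqn_leq leqk andbT.
have [_ _ min_next] := next_primeP (odd_prime k).
rewrite [odd_prime k.+1]iterS; apply: min_next => //.
by rewrite ltnNge; apply/negP=> /mink; rewrite ltnn.
Qed.

(* Main.v *)
Require Import Defs.
From mathcomp Require Import all_boot zify.

(** Let [q] be the [k]-th odd prime and [n] even with [q < n <= 2q + 2].  If
    some [n - p_i] with [i <= k] has a prime factor [p >= q], then
    [n - p_i <= n - 3 < 2p] forces [n - p_i = p]; so (C) makes some [n - p_i]
    with [i <= k] prime.  For [n = 2q + 2] this prime lies strictly between [q]
    and [2q], so (C) itself supplies Bertrand's postulate: the next prime after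
    [q] is less than [2q].  Hence the intervals [(q, 2q + 2]] cover all
    [n > 3]. *)

Lemma odd_prime_homo : {homo odd_prime : i j / i <= j}.
Proof. by apply: homo_leq leqnn leq_trans _ => i; apply/ltnW/odd_prime_ltS. Qed.

Lemma odd_prime_ge3 (k : nat) : 1 <= k -> 3 <= odd_prime k.
Proof.
move=> k_gt0; apply: (@leq_trans (odd_prime 1)); last exact: odd_prime_homo.
exact: (odd_prime_ltS 0).
Qed.

Lemma prime_odd_prime (k : nat) : 1 <= k -> prime (odd_prime k).
Proof. by move=> k_gt0; have [] := (odd_primeP (odd_prime k)).2; first by exists k. Qed.

Lemma odd_prime_S_min (k r : nat) :
  prime r -> odd_prime k < r -> odd_prime k.+1 <= r.
Proof.
by rewrite [odd_prime k.+1]iterS; case: (next_primeP (odd_prime k)) => _ _; apply.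
Qed.

(** Induction on [n] from [4], just above [odd_prime 1 = 3]: passing to [n.+1] keeps [k] unless [n]
    equals [odd_prime k.+1], when [k] rises by one. *)
Lemma odd_prime_bracket (n : nat) :
  3 < n -> exists2 k, 1 <= k & odd_prime k < n <= odd_prime k.+1.
Proof.
have p1E : odd_prime 1 = 3.
  by apply/eqP; rewrite eqn_leq odd_prime_ge3 // odd_prime_S_min.
elim: n => // n IHn; rewrite ltnS leq_eqVlt => /predU1P[<-|/IHn].
  by exists 1; have := odd_prime_ltS 1; rewrite ?p1E.
case=> k k_gt0 /andP[ltkn]; rewrite leq_eqVlt => /predU1P[->|ltnk].
  by exists k.+1; rewrite // ltnSn odd_prime_ltS.
by exists k; rewrite // ltnk ltnW.
Qed.

Theorem theorem3
  (C : forall k n : nat,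
         1 <= k -> 6 <= n -> ~~ odd n -> odd_prime k < n ->
         (forall i : nat, 1 <= i <= k -> ~~ prime (n - odd_prime i)) ->
         exists2 i : nat, 1 <= i <= k &
           exists p : nat,
             [/\ prime p, p %| n - odd_prime i & odd_prime k <= p]) :
  forall n : nat, 6 <= n -> ~~ odd n ->
    exists p : nat, [/\ prime p, p < n & prime (n - p)].
Proof.
have near k n : 1 <= k -> 6 <= n -> ~~ odd n ->
    odd_prime k < n <= (odd_prime k).*2.+2 ->
    exists2 i, 1 <= i <= k & prime (n - odd_prime i).
  move=> k_gt0 n_ge6 even_n /andP[ltkn lenk].
  (* The search over [i] is finite, hence decidable; its failure is exactly the premise of (C). *)
  have [/hasP[i] | /hasPn none] :=
      boolP (has (fun i => prime (n - odd_prime i)) (iota 1 k)).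
    by rewrite mem_iota add1n ltnS; exists i.
  have [i|i ik [p [pr_p /dvdnP[m Dm] lekp]]] := C k n k_gt0 n_ge6 even_n ltkn.
    by move=> ik; apply: none; rewrite mem_iota add1n ltnS.
  exists i => //; have /andP[i_gt0 leik] := ik.
  have := odd_prime_ge3 _ i_gt0; have := odd_prime_homo _ _ leik => le_ik ge3.
  suff m1 : m = 1 by rewrite Dm m1 mul1n.
  (* [m = 0] contradicts [odd_prime i <= odd_prime k < n]; [m >= 2] would give
     [n - odd_prime i >= 2p], yet it is at most [2 * odd_prime k - 1]. *)
  by case: m Dm => [|[|m]] //; rewrite ?mulSn; lia.
have bertrand k : 1 <= k -> odd_prime k.+1 < (odd_prime k).*2.
  move=> k_gt0; have k3 := odd_prime_ge3 _ k_gt0.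
  have [||||i /andP[i_gt0 leik] pr_r] := near k (odd_prime k).*2.+2 => //.
  - by lia.
  - by rewrite /= odd_double.
  - by lia.
  have := odd_prime_ge3 _ i_gt0; have le_ik := odd_prime_homo _ _ leik => ge3.
  (* With [q = odd_prime k], [3 <= odd_prime i <= q] puts the prime [2q + 2 - odd_prime i] between
     [q + 2] and [2q - 1]. *)
  by apply: leq_ltn_trans (odd_prime_S_min _ _ pr_r _) _; lia.
move=> n n_ge6 even_n.
have [|k k_gt0 /andP[ltkn lenk]] := odd_prime_bracket n; first by lia.
have [|i /andP[i_gt0 leik] pr_r] := near k n k_gt0 n_ge6 even_n.
  by have := bertrand k k_gt0; lia.
exists (odd_prime i); split=> //; first exact: prime_odd_prime.
exact: leq_ltn_trans (odd_prime_homo _ _ leik) ltkn.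
Qed.
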